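(* Let $F$ be a linear cone over a totally ordered field $\mathbb{K}$. Then there exists at most one span of $F$, up to unique isomorphism of $\mathbb{K}$-vector spaces: if $(V_1,\iota_1)$ and $(V_2,\iota_2)$ are both spans of $F$, then there is a unique isomorphism of $\mathbb{K}$-vector spaces $\Psi: V_1 \to V_2$ with $\Psi \circ \iota_1 = \iota_2$.
   Context: A totally ordered field is a field $\mathbb{K}$ with a total order $\leq$ such that $\mu\le\lambda$ implies $\mu+\nu\le\lambda+\nu$ for all $\nu \in \mathbb{K}$, and $\lambda,\mu\ge 0$ implies $\lambda\mu\ge 0$; $\mathbb{K}_+=\{\lambda\in\mathbb{K}:\lambda\ge0\}$. A linear cone over $\mathbb{K}$ is a commutative, cancellative monoid $(F,+)$ with a scalar multiplication $\mathbb{K}_+\times F\to F$ such that $\lambda(v+w)=\lambda v+\lambda w$, $(\lambda+\mu)v=\lambda v+\mu v$, $\lambda(\mu v)=(\lambda\mu)v$, $1v=v$ for all $\lambda,\mu\in\mathbb{K}_+$, $v,w\in F$. If $W$ is a linear cone over $\mathbb{K}$ or a $\mathbb{K}$-vector space, a map $f:F\to W$ is $\mathbb{K}_+$-linear if $f(\lambda v+\mu w)=\lambda f(v)+\mu f(w)$ for all $\lambda,\mu\in\mathbb{K}_+$, $v,w\in F$. A span of $F$ is a $\mathbb{K}$-vector space $V$ together with a $\mathbb{K}_+$-linear map $\iota:F\to V$ such that for every $\mathbb{K}$-vector space $W$ and every $\mathbb{K}_+$-linear map $f:F\to W$ there is a unique $\mathbb{K}$-linear map $\tilde f:V\to W$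 with $f=\tilde f\circ\iota$. *)

(* Defs.v *)
From HB Require Import structures.
From mathcomp Require Import all_boot all_order all_algebra.

Set Implicit Arguments.
Unset Strict Implicit.
Unset Printing Implicit Defensive.

Import Order.TTheory GRing.Theory Num.Theory.
Local Open Scope ring_scope.

Record nonneg (K : realFieldType) := Nonneg {
  nonneg_val :> K;
  _ : nonneg_val \is Num.nneg
}.

HB.instance Definition _ (K : realFieldType) :=
  [isSub for @nonneg_val K].
HB.instance Definition _ (K : realFieldType) :=
  [Choice of nonneg K by <:].
HB.instance Definition _ (K : realFieldType) :=
  [SubChoice_isSubComNzSemiRing of nonneg K by <:].

HB.mixin Record Nmodule_isCancellative F of GRing.Nmodule F := {
  cone_addrI : right_injective (@GRing.add F)
}.

(* A semimodule over K_+ differs from the scalar axioms of a linear cone only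
   by the law [0 *: v = 0], which cancellation makes redundant: see the
   factory [Nmodule_isLinearCone]. *)
#[short(type="linearConeType")]
HB.structure Definition LinearCone (K : realFieldType) :=
  {F of GRing.LSemiModule (nonneg K) F & Nmodule_isCancellative F}.

HB.factory Record Nmodule_isLinearCone (K : realFieldType) F
    of GRing.Nmodule F := {
  cone_scale : nonneg K -> F -> F;
  cone_addI : forall u v w : F, u + v = u + w -> v = w;
  cone_scaleDr : forall l v w,
    cone_scale l (v + w) = cone_scale l v + cone_scale l w;
  cone_scaleDl : forall l m v,
    cone_scale (l + m) v = cone_scale l v + cone_scale m v;
  cone_scaleA : forall l m v,
    cone_scale l (cone_scale m v) = cone_scale (l * m) v;
  cone_scale1 : forall v, cone_scale 1 v = v
}.

HB.builders Context K F of Nmodule_isLinearCone K F.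

Fact cone_scale0r v : cone_scale 0 v = 0.
Proof.
by apply: (@cone_addI (cone_scale 0 v)); rewrite -cone_scaleDl !addr0.
Qed.

HB.instance Definition _ := GRing.Nmodule_isLSemiModule.Build (nonneg K) F
  cone_scaleA cone_scale0r cone_scale1 cone_scaleDr
  (fun v l m => cone_scaleDl l m v).
HB.instance Definition _ := Nmodule_isCancellative.Build F cone_addI.

HB.end.

Definition nonneg_linear (K : realFieldType) (F : linearConeType K)
    (W : lmodType K) (f : F -> W) : Prop :=
  forall (l m : nonneg K) (v w : F),
    f (l *: v + m *: w) = (l : K) *: f v + (m : K) *: f w.

(* Linear maps are compared pointwise, since Leibniz equality on
   [{linear V -> W}] is intensional. *)
Definition is_span (K : realFieldType) (F : linearConeType K)
    (V : lmodType K) (iota : F -> V) : Prop :=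
  nonneg_linear iota /\
  forall (W : lmodType K) (f : F -> W), nonneg_linear f ->
    exists2 g : {linear V -> W},
      f =1 g \o iota &
      forall h : {linear V -> W}, f =1 h \o iota -> h =1 g.

(* Main.v *)
Require Import Defs.
From mathcomp Require Import all_boot all_order all_algebra.
Import GRing.Theory.
Local Open Scope ring_scope.

(** A span is an initial object among the nonneg-linear maps out of [F], so the
    usual argument for universal objects applies.  Each span factors through
    the other; both round trips are linear endomorphisms of a span that fix its
    structure map, hence are identities ([span_endo_id]), and the two
    factorizations are mutually inverse ([span_factor_cancel]).  Uniqueness of
    the isomorphism is uniqueness of the factorization of [iota2] through
    [iota1]. *)

(** The identity is another linear map factoring [iota] through itself, and a
    span admits only one. *)
Lemma span_endo_id (K : realFieldType) (F : linearConeType K)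
    (V : lmodType K) (iota : F -> V) (g : {linear V -> V}) :
  is_span iota -> g \o iota =1 iota -> g =1 id.
Proof.
move=> [iota_lin univ] g_iota v.
have [e _ e_uniq] := univ V iota iota_lin.
rewrite (e_uniq g) => [|x]; last exact/esym/g_iota.
by rewrite -(e_uniq idfun).
Qed.

Lemma span_factor_cancel (K : realFieldType) (F : linearConeType K)
    (V W : lmodType K) (iota : F -> V) (kappa : F -> W)
    (g : {linear V -> W}) (h : {linear W -> V}) :
  is_span iota -> kappa =1 g \o iota -> iota =1 h \o kappa -> cancel g h.
Proof.
move=> iota_span g_iota h_kappa.
apply: (@span_endo_id K F V iota (h \o g) iota_span) => x /=.
by rewrite [RHS]h_kappa /= g_iota.
Qed.

Theorem lemma2p6 (K : realFieldType) (F : linearConeType K)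
  (V1 V2 : lmodType K) (iota1 : F -> V1) (iota2 : F -> V2)
  (span1 : is_span iota1) (span2 : is_span iota2) :
  exists Psi : {linear V1 -> V2},
    [/\ bijective Psi,
        Psi \o iota1 =1 iota2 &
        forall Phi : {linear V1 -> V2},
          bijective Phi -> Phi \o iota1 =1 iota2 -> Phi =1 Psi].
Proof.
have [iota1_lin univ1] := span1; have [iota2_lin univ2] := span2.
have [g g_iota g_uniq] := univ1 V2 iota2 iota2_lin.
have [h h_iota _] := univ2 V1 iota1 iota1_lin.
exists g; split=> [|x|Phi _ Phi_iota].
- exists h; first exact: span_factor_cancel span1 g_iota h_iota.
  exact: span_factor_cancel span2 h_iota g_iota.
- by rewrite g_iota.
- by apply: g_uniq => x; rewrite Phi_iota.
Qed.
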